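(* Any two finite groups of the same square-free order are compatible with each other.
   Context: Two finite groups $L_1,L_2$ are compatible if there exists a finite group $G$ with isomorphic normal subgroups $N_1\cong N_2$ such that $L_1\cong G/N_1$ and $L_2\cong G/N_2$. *)

(* Defs.v *)
From mathcomp Require Import all_boot all_fingroup.

Set Implicit Arguments.
Unset Strict Implicit.
Unset Printing Implicit Defensive.

(* The witness group G may live in any finGroupType, unrelated to the ambient
   types of L1 and L2. *)
Definition compatible (gT1 gT2 : finGroupType)
    (L1 : {group gT1}) (L2 : {group gT2}) : Prop :=
  exists (gT : finGroupType) (G N1 N2 : {group gT}),
    [/\ N1 <| G, N2 <| G, N1 \isog N2, L1 \isog G / N1 & L2 \isog G / N2]%g.

(* 0 is not square-free, as 2 ^ 2 %| 0. *)
Definition square_free (n : nat) : Prop :=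
  forall d : nat, d ^ 2 %| n -> d = 1.

(* Main.v *)
(* Compatibility passes from Q1, Q2 to semidirect products A ><| Q1, A ><| Q2
   with abelian A: if H maps onto Q_i with kernel M_i and M1 is isomorphic to
   M2, let G be the regular wreath product A^H ><| H, mapping onto A ><| Q_i by
   (f, h) |-> (\prod_x f(x)^x, h), where x acts on A through Q_i. Restricted to
   M_i, the module A^H is a sum of |H : M_i| copies of the regular one, whatever
   the action of Q_i on A, and this makes the two kernels isomorphic.
   In a group of square-free order the Sylow subgroup for the largest prime p
   is normal, since the smallest prime has a normal complement by transfer; so
   the group is Z/p ><| Q by Schur-Zassenhaus, and one concludes by induction. *)

Require Import Defs.
From HB Require Import structures.
From mathcomp Require Import all_boot all_fingroup all_algebra all_solvable.

Set Implicit Arguments.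
Unset Strict Implicit.
Unset Printing Implicit Defensive.

Import GRing.Theory FiniteModule.
Local Open Scope group_scope.

(** * Compatibility as a pair of surjections with isomorphic kernels *)

Lemma card_ker_im (aT rT : finGroupType) (G : {group aT})
    (f : {morphism G >-> rT}) :
  (#|'ker f| * #|f @* G|)%N = #|G|.
Proof. by rewrite card_morphim setIid Lagrange ?subsetIl. Qed.

Lemma compatible_of_morphisms (gT1 gT2 hT : finGroupType)
    (L1 : {group gT1}) (L2 : {group gT2})
    (f1 : {morphism [set: hT] >-> gT1}) (f2 : {morphism [set: hT] >-> gT2}) :
    f1 @* setT = L1 -> f2 @* setT = L2 -> 'ker f1 \isog 'ker f2 ->
  compatible L1 L2.
Proof.
move=> im1 im2 isoK; exists hT, [set: hT]%G, ('ker f1)%G, ('ker f2)%G.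
split; rewrite ?ker_normal //.
  by rewrite -im1 isog_sym first_isog.
by rewrite -im2 isog_sym first_isog.
Qed.

(** Passing to the subtype [[subg G]] makes the source a whole type, over which a wreath product can
    be formed. *)
Lemma quotient_isog_morphism (gT rT : finGroupType)
    (G N : {group gT}) (L : {group rT}) :
    N <| G -> L \isog G / N ->
  exists f : {morphism [set: [subg G]] >-> rT},
    f @* setT = L /\ 'ker f \isog N.
Proof.
move=> nsNG; rewrite isog_sym => /isogP[g injg img].
have im_sub : sgval @* [set: [subg G]] = G by exact: im_sgval.
pose q := comp_morphism (sgval_morphism G) (coset_morphism N).
have imq : q @* [set: [subg G]] = G / N by rewrite morphim_comp im_sub.
have sTq : [set: [subg G]] \subset 'dom q.
  by rewrite -sub_morphim_pre ?subsetT // im_sub normal_norm.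
have sTD : [set: [subg G]] \subset q @*^-1 (G / N).
  by rewrite -sub_morphim_pre // imq.
exists (restrm_morphism sTD (comp_morphism q g)); split => /=.
  by rewrite morphim_restrm setIid morphim_comp imq.
rewrite ker_restrm setTI ker_comp (trivgP injg) -kerE ker_comp ker_coset.
have sNim : N \subset sgval @* [set: [subg G]] by rewrite im_sub normal_sub.
by rewrite -{2}(morphpreK sNim) sub_isog ?injm_sgval ?subsetT.
Qed.

Lemma compatible_morphisms (gT1 gT2 : finGroupType)
    (L1 : {group gT1}) (L2 : {group gT2}) :
    compatible L1 L2 ->
  exists (hT : finGroupType) (f1 : {morphism [set: hT] >-> gT1})
      (f2 : {morphism [set: hT] >-> gT2}),
    [/\ f1 @* setT = L1, f2 @* setT = L2 & 'ker f1 \isog 'ker f2].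
Proof.
case=> gT [G [N1 [N2 [nsN1 nsN2 isoN isoL1 isoL2]]]].
have [f1 [im1 ker1]] := quotient_isog_morphism nsN1 isoL1.
have [f2 [im2 ker2]] := quotient_isog_morphism nsN2 isoL2.
exists _, f1, f2; split=> //.
by apply: isog_trans ker1 (isog_trans isoN _); rewrite isog_sym.
Qed.

(** * The regular wreath product and its evaluation maps *)

Section Wreath.

Variables (V : finZmodType) (hT : finGroupType).

(* The regular wreath product of V by hT; hT acts on functions by right
   translation of the argument. *)
Definition wreath : Type := {ffun hT -> V} * hT.

HB.instance Definition _ := Finite.on wreath.

Definition wreath_mul (u v : wreath) : wreath :=
  ([ffun x => u.1 x + v.1 (x * u.2)%g]%R, u.2 * v.2).
Definition wreath_one : wreath := ([ffun=> 0%R], 1).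
Definition wreath_inv (u : wreath) : wreath :=
  ([ffun x => - u.1 (x * u.2^-1)%g]%R, u.2^-1).

Lemma wreath_mulA : associative wreath_mul.
Proof.
move=> u v w; congr pair; last exact: mulgA.
by apply/ffunP=> x; rewrite !ffunE /= addrA mulgA.
Qed.

Lemma wreath_mul1 : left_id wreath_one wreath_mul.
Proof.
move=> [f h]; congr pair; last exact: mul1g.
by apply/ffunP=> x; rewrite !ffunE /= add0r mulg1.
Qed.

Lemma wreath_mulV : left_inverse wreath_one wreath_inv wreath_mul.
Proof.
move=> [f h]; congr pair; last exact: mulVg.
by apply/ffunP=> x; rewrite !ffunE /= addNr.
Qed.

HB.instance Definition _ :=
  Finite_isGroup.Build wreath wreath_mulA wreath_mul1 wreath_mulV.

Lemma wreathM1 (u v : wreath) x : (u * v).1 x = (u.1 x + v.1 (x * u.2)%g)%R.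
Proof. by rewrite ffunE. Qed.

Lemma wreathM2 (u v : wreath) : (u * v).2 = u.2 * v.2.
Proof. by []. Qed.

Section Evaluation.

Variables (gT : finGroupType) (K : {group gT}) (abelK : abelian K).
Variables (j : {additive V -> fmod_of abelK}).
Variable phi : {morphism [set: hT] >-> gT}.
Hypothesis nKphi : phi @* setT \subset 'N(K).

(** [V] carries no action: the twist comes only from [phi]. The map [j] lets a single wreath product
    evaluate into different groups. *)
Definition twisted_sum (f : {ffun hT -> V}) : fmod_of abelK :=
  (\sum_x j (f x) ^@ phi x)%R.

Definition wreath_eval (u : wreath) : gT :=
  fmval (twisted_sum u.1) * phi u.2.

Lemma phi_norm x : phi x \in 'N(K).
Proof. by rewrite (subsetP nKphi) ?mem_morphim ?inE. Qed.

Lemma wreath_evalM : {in setT &, {morph wreath_eval : u v / u * v}}.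
Proof.
move=> u v _ _; rewrite /wreath_eval wreathM2 morphM ?inE //.
have -> : twisted_sum (u * v).1 =
    (twisted_sum u.1 + twisted_sum v.1 ^@ (phi u.2)^-1%g)%R.
  rewrite /twisted_sum (actr_sum (phi u.2)^-1) /=.
  (* Replacing [x] by [x * u.2] undoes the translation in the product, at the cost of the factor
     [(phi u.2)^-1]. *)
  rewrite [X in (_ + X)%R](reindex_inj (mulIg u.2)) /= -big_split /=.
  apply: eq_bigr => x _; rewrite wreathM1 raddfD actAr; congr (_ + _)%R.
  by rewrite morphM ?inE // actrM ?phi_norm // actrK.
rewrite fmvalA /= fmvalJ ?groupV ?phi_norm // conjgE invgK !mulgA.
by rewrite mulgKV.
Qed.

Canonical wreath_eval_morphism := Morphism wreath_evalM.

Hypothesis tiK : K :&: phi @* setT = 1.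

(** A product of an element of [K] and one of the image of [phi] is 1 only if both are, since these
    groups meet trivially. *)
Lemma ker_wreath_evalP (u : wreath) :
  reflect (twisted_sum u.1 = 0%R /\ u.2 \in 'ker phi) (u \in 'ker wreath_eval).
Proof.
rewrite !inE /=; apply: (iffP eqP) => [e | [s0 /eqP p1]]; last first.
  by rewrite /wreath_eval s0 p1 mulg1.
have ephi : phi u.2 = (fmval (twisted_sum u.1))^-1.
  by apply: (mulgI (fmval (twisted_sum u.1))); rewrite mulgV.
have : phi u.2 \in K :&: phi @* setT.
  by rewrite inE mem_morphim ?inE // andbT ephi groupV fmodP.
rewrite tiK => /set1P p1; split; last by rewrite p1.
by apply: fmod_inj; rewrite -[LHS]invgK -ephi p1 invg1.
Qed.

Hypothesis j_surj : forall a, exists v, j v = a.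

Lemma im_wreath_eval : wreath_eval @* setT = K * phi @* setT.
Proof.
apply/setP=> y; apply/morphimP/mulsgP.
  case=> u _ _ ->; exists (fmval (twisted_sum u.1)) (phi u.2) => //.
    exact: fmodP.
  by rewrite mem_morphim ?inE.
case=> a _ Ka /morphimP[h _ _ ->] ->.
have [v jv] := j_surj (fmod abelK a).
(* A function supported at 1, where [phi] acts trivially, already reaches every element of [K]. *)
exists ([ffun x : hT => if x == 1 then v else 0%R], h : hT) => //.
rewrite /= /wreath_eval /twisted_sum (bigD1 1) //= big1 => [|x xn1].
  by rewrite ffunE eqxx morph1 actr1 jv addr0 [fmval _]fmodK.
by rewrite ffunE (negPf xn1) raddf0 act0r.
Qed.

End Evaluation.

End Wreath.

(** * Matching the two kernels, and compatibility of semidirect products *)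

Lemma coset_compatible_injection (hT : finGroupType) (M1 M2 : {group hT})
    (s : {morphism M1 >-> hT}) :
    'injm s -> s @* M1 = M2 ->
  exists2 b : hT -> hT,
    injective b & forall x m, m \in M1 -> b (x * m) = b x * s m.
Proof.
move=> injs ims.
(* [hT] is a free right [M1]-set in two ways, directly and through [s], with equally many orbits.
   Cosets are matched by position in the enumerations ([c]), and [d x] is the [M1]-part of [x]
   relative to the chosen representative. *)
pose e1 := enum (lcosets M1 setT); pose e2 := enum (lcosets M2 setT).
have sz12 : size e1 = size e2.
  rewrite -!cardE !card_lcosets -!divgS ?subsetT //.
  by rewrite -ims card_injm.
have e1x x : x *: M1 \in e1 by rewrite mem_enum; apply/lcosetsP; exists x.
pose c X := nth set0 e2 (index X e1).
have c_mem x : c (x *: M1) \in lcosets M2 setT.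
  by rewrite -mem_enum mem_nth // -sz12 index_mem.
have c_inj x y : c (x *: M1) = c (y *: M1) -> x *: M1 = y *: M1.
  move/eqP; rewrite nth_uniq -?sz12 ?index_mem ?enum_uniq // => /eqP eqi.
  by rewrite -(nth_index set0 (e1x x)) eqi nth_index.
pose d x := (repr (x *: M1))^-1 * x.
have d_mem x : d x \in M1.
  have := mem_repr x (lcoset_refl M1 x).
  by rewrite -mem_lcoset lcoset_sym.
exists (fun x => repr (c (x *: M1)) * s (d x)) => [x y /= eqxy | x m Mm /=].
  have c_coset z : repr (c (z *: M1)) * s (d z) \in c (z *: M1).
    have /lcosetsP[t _ ->] := c_mem z.
    have /lcosetP[m Mm ->] := mem_repr t (lcoset_refl M2 t).
    by rewrite -mulgA mem_lcoset mulKg groupM // -ims mem_morphim.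
  have eqc : c (x *: M1) = c (y *: M1).
    have := c_coset x; have := c_coset y; rewrite eqxy.
    have /lcosetsP[t _ ->] := c_mem x; have /lcosetsP[w _ ->] := c_mem y.
    by move=> /lcoset_eqP ? /lcoset_eqP <-.
  move: eqxy; rewrite eqc => /mulgI/(injmP injs) => /(_ (d_mem x) (d_mem y)).
  by rewrite /d (c_inj _ _ eqc) => /mulgI.
have eqm : (x * m) *: M1 = x *: M1.
  by apply/lcoset_eqP; rewrite mem_lcoset mulKg.
by rewrite -mulgA -morphM ?d_mem // /d eqm -[_ * x * m]mulgA.
Qed.

Lemma isog_fmod_bijection (gT1 gT2 : finGroupType)
    (K1 : {group gT1}) (K2 : {group gT2})
    (abelK1 : abelian K1) (abelK2 : abelian K2) :
    K1 \isog K2 ->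
  exists j : {additive fmod_of abelK1 -> fmod_of abelK2}, bijective j.
Proof.
case/isogP=> f injf imf.
pose j (u : fmod_of abelK1) := fmod abelK2 (f (fmval u)).
have K1v (u : fmod_of abelK1) : fmval u \in K1 by exact: fmodP.
have Kf (u : fmod_of abelK1) : f (fmval u) \in K2 by rewrite -imf mem_morphim.
have jD u v : j (u + v)%R = (j u + j v)%R.
  by rewrite /j -fmodM // -morphM.
have jB : zmod_morphism j.
  by move=> u v; apply: (addIr (j v)); rewrite -jD !subrK.
pose ja : {additive fmod_of abelK1 -> fmod_of abelK2} :=
  HB.pack j (GRing.isZmodMorphism.Build _ _ j jB).
exists ja; exists (fun w => fmod abelK1 (invm injf (fmval w))) => u /=.
  by rewrite /j [fmval _](fmodK abelK2) // invmE // fmvalK.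
have im_u : fmval u \in f @* K1 by rewrite imf; apply: fmodP.
rewrite /j [fmval (fmod _ _)](fmodK abelK1) ?invmK ?fmvalK //.
by rewrite -(im_invm injf) mem_morphim.
Qed.

Lemma compatible_sdprod (gT1 gT2 : finGroupType)
    (L1 K1 Q1 : {group gT1}) (L2 K2 Q2 : {group gT2}) :
    K1 ><| Q1 = L1 -> K2 ><| Q2 = L2 -> abelian K1 -> K1 \isog K2 ->
  compatible Q1 Q2 -> compatible L1 L2.
Proof.
move=> /sdprodP[_ defL1 nKQ1 tiKQ1] /sdprodP[_ defL2 nKQ2 tiKQ2] abelK1 isoK.
have abelK2 : abelian K2 by rewrite -(isog_abelian isoK).
case/compatible_morphisms=> hT [phi1 [phi2 [im1 im2 isoM]]].
have [j bij_j] := isog_fmod_bijection abelK1 abelK2 isoK.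
have [j' jK j'K] := bij_j.
have /isogP[s injs ims] := isoM.
have [b injb bM] := coset_compatible_injection injs ims.
have [b' bK b'K] := injF_bij injb.
have nK1 : phi1 @* setT \subset 'N(K1) by rewrite im1.
have nK2 : phi2 @* setT \subset 'N(K2) by rewrite im2.
have ti1 : K1 :&: phi1 @* setT = 1 by rewrite im1.
have ti2 : K2 :&: phi2 @* setT = 1 by rewrite im2.
(* Both evaluations start from the wreath product over the module of [K1]; its values enter [K1] by
   the identity and [K2] by [j]. *)
pose id1 : {additive fmod_of abelK1 -> fmod_of abelK1} := idfun.
pose F1 := wreath_eval_morphism id1 nK1.
pose F2 := wreath_eval_morphism j nK2.
have imF1 : F1 @* setT = L1.
  by rewrite im_wreath_eval ?im1 // => a; exists a.
have imF2 : F2 @* setT = L2.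
  by rewrite im_wreath_eval ?im2 // => a; exists (j' a).
have ker1P u := ker_wreath_evalP id1 nK1 ti1 u.
have ker2P u := ker_wreath_evalP j nK2 ti2 u.
apply: (compatible_of_morphisms imF1 imF2).
(* With M1 = ker phi1 and M2 = ker phi2 identified by s, the bijection b
   matches their translation actions on hT; the rescaling is constant on cosets
   of M1 and turns the phi1-twisted sum into the phi2-twisted one. *)
pose twist x y v := j' (j (v ^@ phi1 x) ^@ (phi2 y)^-1)%R.
have twistD x y : {morph twist x y : v w / (v + w)%R >-> (v + w)%R}.
  by move=> v w; rewrite /twist actAr raddfD actAr; apply: (can_inj jK);
    rewrite raddfD !j'K.
pose th (u : wreath (fmod_of abelK1) hT) : wreath (fmod_of abelK1) hT :=
  ([ffun y => twist (b' y) y (u.1 (b' y))], s u.2).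
have thM : {in 'ker F1 &, {morph th : u v / u * v}}.
  move=> u v /ker1P[_ Mu] /ker1P[_ Mv].
  congr pair; last by rewrite /= morphM.
  apply/ffunP=> y; rewrite !ffunE /= twistD; congr (_ + _)%R.
  have -> : b' (y * s u.2) = b' y * u.2.
    by apply: (can_inj bK); rewrite b'K bM // b'K.
  rewrite /twist !morphM ?inE // (mker Mu) mulg1.
  have Ms : s u.2 \in 'ker phi2 by rewrite -ims mem_morphim.
  by rewrite (mker Ms) mulg1.
have injth : 'injm (Morphism thM).
  apply/injmP=> u v /ker1P[_ Mu] /ker1P[_ Mv] /= [eq1 eq2].
  case: u v Mu Mv eq1 eq2 => [f h] [g k] /= Mh Mk eq1 eq2.
  congr pair; last exact: (injmP injs).
  apply/ffunP=> x; have := congr1 (fun t : {ffun _} => t (b x)) eq1.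
  rewrite !ffunE bK => /(can_inj j'K)/(can_inj (actrK _))/(can_inj jK).
  exact: (can_inj (actrK _)).
have sth : Morphism thM @* 'ker F1 \subset 'ker F2.
  apply/subsetP=> _ /morphimP[u _ /ker1P[s0 Mu] ->].
  apply/ker2P; split; last by rewrite /= -ims mem_morphim.
  (* At index [b x] the twist cancels, leaving [j] of the [phi1]-twisted term; the sum is thus [j]
     of 0. *)
  rewrite -[RHS](raddf0 j) -s0 /twisted_sum raddf_sum (reindex_inj injb) /=.
  by apply: eq_bigr => x _; rewrite ffunE bK /twist j'K actrKV.
(* The embedding of ['ker F1] into ['ker F2] is onto by counting: the kernels of [phi1] and [phi2]
   have equal order, hence so do the images, [L1] and [L2], and finally the kernels of [F1] and
   [F2]. *)
have cardQ : #|Q1| = #|Q2|.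
  have := card_ker_im phi1; rewrite -(card_ker_im phi2) im1 im2.
  by rewrite (card_isog isoM) => /eqP; rewrite eqn_pmul2l ?cardG_gt0 // => /eqP.
have cardL : #|L1| = #|L2|.
  rewrite -defL1 -defL2 !TI_cardMg // cardQ.
  by rewrite (card_isog isoK).
apply/isogP; exists (Morphism thM) => //.
apply/eqP; rewrite eqEcard sth card_injm //=.
have := card_ker_im F1; rewrite -(card_ker_im F2) imF1 imF2 cardL => /eqP.
by rewrite eqn_pmul2r ?cardG_gt0 // => /eqP/esym/eq_leq.
Qed.

(** * Normal Sylow subgroups in groups of square-free order *)

Lemma square_free_dvd (m n : nat) : m %| n -> square_free n -> square_free m.
Proof. by move=> mn sfn d dm; apply: sfn; apply: dvdn_trans mn. Qed.

Lemma square_free_partn (n p : nat) :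
  square_free n -> prime p -> p %| n -> (n`_p)%N = p.
Proof.
move=> sfn pp pn; have n0 : 0 < n.
  by rewrite lt0n; apply/eqP=> n0; have := sfn 2%N; rewrite n0 => /(_ isT).
have log1 : logn p n = 1%N.
  apply/eqP; rewrite eqn_leq logn_gt0 mem_primes pp n0 pn /= andbT leqNgt.
  by rewrite -pfactor_dvdn //; apply/negP=> /sfn p1; rewrite p1 in pp.
by rewrite p_part log1 expn1.
Qed.

(* The transfer into P restricts on P to the power map x |-> x ^+ #|G : P|, an
   automorphism, so its kernel is a complement to P. *)
Lemma prime_central_Sylow_complement (gT : finGroupType) (G P : {group gT}) :
    P \subset G -> prime #|P| -> coprime #|P| #|G : P| ->
    'N_G(P) \subset 'C(P) ->
  exists2 K : {group gT}, K <| G & (#|K| * #|P|)%N = #|G|.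
Proof.
move=> sPG prP coP sNC.
have abelP : abelian P by rewrite cyclic_abelian ?prime_cyclic.
have abelI : abelian (idm P @* P) by rewrite morphim_idm.
pose V := transfer_morphism G abelI.
have VP g : g \in P -> V g = fmod abelI (g ^+ #|G : P|).
  move=> Pg; have Gg := subsetP sPG g Pg.
  have trX := transversalP (rcosets_cycle_partition sPG Gg).
  (* The transfer is a sum over the cycles of [g] on the cosets of [P], whose lengths add up to
     [#|G : P|]. It remains to remove the conjugation from each term. *)
  rewrite /= (transfer_cycle_expansion sPG abelI Gg trX).
  rewrite -(sum_index_rcosets_cycle sPG Gg trX).
  set X := transversal _ _ in trX *.
  transitivity (\sum_(x in X) fmod abelI (g ^+ #|<[g]> : P :* x|))%R.
    apply: eq_bigr => x Xx; rewrite /restrm /=; congr fmod.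
    have Gx : x \in G by apply: subsetP Xx; case/and3P: trX.
    have := mulg_exp_card_rcosets P g x; set y := g ^+ _.
    have Py : y \in P by rewrite groupX.
    rewrite mem_rcoset => Pyx; have {}Pyx : y ^ x^-1 \in P.
      by rewrite conjgE invgK mulgA.
    (* If [y] is nontrivial it generates [P], which has prime order; then [x^-1] normalizes [P],
       hence centralizes it, and the conjugate of [y] is [y]. *)
    have [-> | y1] := eqVneq y 1; first by rewrite conj1g.
    have defP : <[y]> = P.
      have := prime_subgroupVti <[y]> prP; case=> [sPy | ti].
        by apply/eqP; rewrite eqEsubset sPy cycle_subG Py.
      have : y \in <[y]> :&: P by rewrite inE cycle_id.
      by rewrite ti inE (negPf y1).
    have Nx : x^-1 \in 'N_G(P).
      by rewrite inE groupV Gx inE -{1}defP -cycleJ cycle_subG.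
    by rewrite /= /conjg -(centP (subsetP sNC _ Nx)) ?mulKg.
  have Ig : g \in idm P @* P by rewrite morphim_idm.
  rewrite fmodX // -sumrMnr; apply: eq_bigr => x _.
  by rewrite fmodX.
pose K := ('ker V)%G.
have tiPK : P :&: K = 1.
  apply/trivgP/subsetP=> g /setIP[Pg Kg].
  have := mker Kg; rewrite VP // => /(congr1 val) /=.
  have Ig : g ^+ #|G : P| \in idm P @* P by rewrite morphim_idm ?groupX.
  rewrite [val _](fmodK abelI Ig) => gm1.
  (* The order of [g] divides the coprime numbers [#|P|] and [#|G : P|]. *)
  rewrite inE -order_eq1 -dvdn1 -(eqP coP) dvdn_gcd order_dvdG //=.
  by rewrite order_dvdn; apply/eqP.
exists K; first exact: ker_normal.
(* The image of [V] has order [#|P|]: at least that because [V] is injective on [P], at most that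
   because the target is a copy of [P]. *)
apply/eqP; rewrite -(card_ker_im V) eqn_pmul2l ?cardG_gt0 // eqn_leq.
apply/andP; split.
  have -> : #|P| = #|V @* P|.
    by rewrite card_morphim (setIidPr sPG) -indexgI tiPK indexg1.
  by rewrite subset_leq_card ?morphimS.
apply: leq_trans (max_card _) _.
have <- : #|idm P @* P| = #|P| by rewrite morphim_idm.
rewrite -(card_imset predT (@fmod_inj _ _ abelI)) subset_leq_card //.
by apply/subsetP=> _ /imsetP[u _ ->]; apply: fmodP.
Qed.

(** For a Sylow [p]-subgroup [P], conjugation maps ['N_G(P)] into a group of order [p - 1]. The
    order of the image divides [#|G|], whose divisors above 1 are at least [p], so the image is
    trivial and [P] is central in its normalizer. *)
Lemma pdiv_normal_complement (gT : finGroupType) (G : {group gT}) :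
    square_free #|G| -> 1 < #|G| ->
  exists2 K : {group gT}, K <| G & (#|K| * pdiv #|G|)%N = #|G|.
Proof.
move=> sfG G1; set p := pdiv #|G|; have prp : prime p := pdiv_prime G1.
have [P sylP] := Sylow_exists p G; have sPG := pHall_sub sylP.
have oP : #|P| = p by rewrite (card_Hall sylP) square_free_partn ?pdiv_dvd.
have prP : prime #|P| by rewrite oP.
rewrite -oP; apply: prime_central_Sylow_complement => //.
  by case/andP: (pHall_Hall sylP).
set A := conj_aut P @* 'N_G(P).
have A1 : A = 1.
  apply/eqP; rewrite trivg_card1 eqn_leq cardG_gt0 andbT leqNgt.
  apply/negP=> cA; have cA_p : #|A| < p.
    have := subset_leq_card (Aut_conj_aut P 'N_G(P)).
    rewrite card_Aut_cyclic ?prime_cyclic // oP totient_prime // => leA.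
    by rewrite (leq_ltn_trans leA) ?prednK ?prime_gt0.
  have cA_G : #|A| %| #|G|.
    by rewrite (dvdn_trans (dvdn_morphim _ _)) ?cardSg ?subsetIl.
  by have := pdiv_min_dvd cA cA_G; rewrite leqNgt cA_p.
by rewrite -ker_conj_aut ker_trivg_morphim subsetIr -/A A1 subxx.
Qed.

(** Induction on the order: [p] is only a bound on the prime divisors, so the hypothesis passes to
    the normal complement [K] of index [q], the least prime. Unless [G] is a [p]-group, [q] differs
    from [p], so ['O_p(K)] is Sylow in [G]; being characteristic in [K], it is normal in [G]. *)
Lemma max_prime_Sylow_normal (gT : finGroupType) (G : {group gT}) p :
    square_free #|G| -> (forall q, prime q -> q %| #|G| -> q <= p) ->
  p.-Sylow(G) 'O_p(G).
Proof.
have [n] := ubnP #|G|; elim: n gT G => // n IHn gT G /ltnSE-leGn sfG maxp.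
have [pG | npG] := boolP (p.-group G).
  by rewrite pcore_pgroup_id // pHallE subxx part_pnat_id /=.
have G1 : 1 < #|G|.
  rewrite ltnNge -trivg_card_le1; apply: contra npG => /eqP->.
  exact: pgroup1.
have [K nsKG oK] := pdiv_normal_complement sfG G1.
set q := pdiv #|G| in oK; have prq : prime q := pdiv_prime G1.
have qp : q != p.
  apply: contra npG => /eqP qp; apply/pgroupP=> r prr rG.
  rewrite inE eqn_leq maxp //= -qp.
  by rewrite pdiv_min_dvd ?prime_gt1.
have dKG : #|K| %| #|G| by rewrite cardSg ?normal_sub.
have ltKG : #|K| < #|G|.
  by rewrite -oK ltn_Pmulr ?prime_gt1 ?cardG_gt0.
have sylK : p.-Sylow(K) 'O_p(K).
  apply: IHn (leq_trans ltKG leGn) (square_free_dvd dKG sfG) _ => r prr rK.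
  by apply: maxp (dvdn_trans rK dKG).
have sylG : p.-Sylow(G) 'O_p(K).
  rewrite pHallE (subset_trans (pcore_sub _ _)) ?normal_sub //=.
  rewrite (card_Hall sylK) -oK partnM ?cardG_gt0 ?prime_gt0 //.
  by rewrite (part_p'nat (n := q)) ?muln1 // pnatE // inE.
by rewrite (normal_Hall_pcore sylG) // (char_normal_trans (pcore_char p K)).
Qed.

Lemma square_free_sdprod (gT : finGroupType) (G : {group gT}) :
    square_free #|G| -> 1 < #|G| ->
  exists K Q : {group gT}, K ><| Q = G /\ #|K| = max_pdiv #|G|.
Proof.
move=> sfG G1; set p := max_pdiv #|G|.
have prp : prime p := max_pdiv_prime G1.
have sylP : p.-Sylow(G) 'O_p(G).
  apply: max_prime_Sylow_normal => // q prq qG.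
  by rewrite max_pdiv_max // mem_primes prq cardG_gt0.
have /splitsP[Q /complP[tiPQ defG]] :=
  SchurZassenhaus_split (pHall_Hall sylP) (pcore_normal p G).
exists 'O_p(G)%G, Q; split; last first.
  by rewrite (card_Hall sylP) square_free_partn ?max_pdiv_dvd.
rewrite sdprodE // (subset_trans _ (gFnorm _ G)) //.
by rewrite -defG mulG_subr.
Qed.

Theorem corollary6p29 (gT1 gT2 : finGroupType)
    (L1 : {group gT1}) (L2 : {group gT2})
    (hcard : #|L1| = #|L2|) (hsf : square_free #|L1|) :
  compatible L1 L2.
Proof.
have [n] := ubnP #|L1|.
elim: n gT1 gT2 L1 L2 hcard hsf => // n IHn gT1 gT2 L1 L2 cardL sfL /ltnSE-leLn.
have [L1gt1 | L1le1] := ltnP 1 #|L1|; last first.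
  have isoL : L1 \isog L2.
    have /card_le1_trivg L2_1 : #|L2| <= 1 by rewrite -cardL.
    rewrite (card_le1_trivg L1le1) L2_1 isog_cyclic_card ?cyclic1 //.
    by rewrite !cards1.
  (* Both groups are trivial, so [L2] over its trivial subgroup is a witness. *)
  exists gT2, L2, 1%G, 1%G.
  have isoL2 := quotient1_isog L2.
  by split; rewrite ?normal1 ?isog_refl //; apply: isog_trans isoL isoL2.
(* Both normal factors have as order the largest prime divisor of the common order, so they are
   isomorphic cyclic groups. *)
have [K1 [Q1 [defL1 oK1]]] := square_free_sdprod sfL L1gt1.
have [||K2 [Q2 [defL2 oK2]]] := @square_free_sdprod _ L2; rewrite -?cardL //.
have prp := max_pdiv_prime L1gt1.
rewrite -cardL in oK2.
have cycK1 : cyclic K1 by rewrite prime_cyclic ?oK1.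
have cycK2 : cyclic K2 by rewrite prime_cyclic ?oK2.
have oL1 := sdprod_card defL1; have oL2 := sdprod_card defL2.
apply: (compatible_sdprod defL1 defL2); first exact: cyclic_abelian.
  by rewrite isog_cyclic_card // cycK2 oK1 oK2 /=.
apply: IHn.
- apply/eqP; rewrite -(eqn_pmul2l (prime_gt0 prp)) -{1}oK1 -oK2.
  by rewrite oL1 oL2 cardL.
- by apply: square_free_dvd sfL; rewrite -oL1 dvdn_mull.
- by rewrite (leq_trans _ leLn) // -oL1 oK1 ltn_Pmull ?prime_gt1 ?cardG_gt0.
Qed.
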